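(* Let $U$ and $V$ be real vector spaces and let $n>2$ be a positive integer. A mapping $Q:U\to V$ satisfies $$n\sum_{1\le i<j\le n}Q(x_i-x_j)=\sum_{i=1}^{n}Q\Big(\sum_{j=1}^{n}x_j-nx_i\Big)\quad\text{for all }x_1,\dots,x_n\in U$$ if and only if it satisfies $$Q(x+y)+Q(x-y)=2Q(x)+2Q(y)\quad\text{for all }x,y\in U.$$ Thus, for every such $Q$, there exists a symmetric biadditive mapping $B:U\times U\to V$ such that $Q(x)=B(x,x)$ for all $x\in U$.
   Context: A mapping $B:U\times U\to V$ is biadditive if it is additive in each variable separately, and symmetric if $B(x,y)=B(y,x)$ for all $x,y\in U$. *)

(* Defs.v *)
From mathcomp Require Import all_boot all_order all_algebra.
From mathcomp Require Import reals.
Set Implicit Arguments.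
Unset Strict Implicit.
Unset Printing Implicit Defensive.
Import GRing.Theory.
Local Open Scope ring_scope.

Definition biadditive (U V : zmodType) (B : U -> U -> V) : Prop :=
  (forall x x' y, B (x + x') y = B x y + B x' y) /\
  (forall x y y', B x (y + y') = B x y + B x y').

Definition symmetric_map (U V : Type) (B : U -> U -> V) : Prop :=
  forall x y, B x y = B y x.

(* Main.v *)
From HB Require Import structures.
Require Import Defs.
From mathcomp Require Import all_boot all_order all_algebra ring.
From mathcomp Require Import reals.
Set Implicit Arguments.
Unset Strict Implicit.
Unset Printing Implicit Defensive.
Import GRing.Theory Num.Theory.
Local Open Scope ring_scope.

(** From the pairs equation one reads off that [Q 0 = 0] and that [Q] is even.
    If n > 3, the tuple (x, -x, y, -y, 0, ..., 0) has sum zero, so its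
    right-hand side is the sum of those of (x, -x, 0, ..., 0) and
    (y, -y, 0, ..., 0); comparing the left-hand sides gives the parallelogram
    law.  If n = 3, the triple (x - y, 2y, -x - y) yields a linear recurrence
    for the sequence Q (x + k y), and the same recurrence for 2y in place of y
    is coprime to it up to the quadratic solutions; eliminating between the two
    gives the parallelogram law.  Conversely, the parallelogram law makes the
    polarization of [Q] biadditive, and both sides of the pairs equation expand
    to n^2 (sum of B(x_i, x_i)) - n B(S, S), with S the sum of the x_i. *)

(** * Deciding identities in abelian groups *)

(* Multiplication with V^2 = 0: it embeds any abelian group V into a commutative
   ring, so that [ring] decides the identities of abelian groups. *)
Definition sqzero (V : zmodType) : Type := (int * V)%type.

Section SquareZeroExtension.
Variable V : zmodType.
Implicit Types p q r : sqzero V.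

HB.instance Definition _ := GRing.Zmodule.copy (sqzero V) (int * V)%type.

Definition sqzero_one : sqzero V := (1, 0).
Definition sqzero_mul p q : sqzero V := (p.1 * q.1, q.2 *~ p.1 + p.2 *~ q.1).

Fact sqzero_mulA : associative sqzero_mul.
Proof.
move=> p q r; congr pair; rewrite /= ?mulrA // !mulrzDl -!mulrzA addrA.
by rewrite (mulrC q.1 p.1) (mulrC r.1 p.1).
Qed.

Fact sqzero_mulC : commutative sqzero_mul.
Proof. by move=> p q; congr pair; rewrite /= (mulrC, addrC). Qed.

Fact sqzero_mul1 : left_id sqzero_one sqzero_mul.
Proof. by case=> a v; congr pair; rewrite /= ?mul1r // mul0rz addr0. Qed.

Fact sqzero_mulDl : left_distributive sqzero_mul +%R.
Proof.
by move=> p q r; congr pair; rewrite /= ?mulrDl // mulrzDr mulrzDl addrACA.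
Qed.

Fact sqzero_one_neq0 : sqzero_one != 0.
Proof. by rewrite xpair_eqE. Qed.

HB.instance Definition _ := GRing.Zmodule_isComNzRing.Build (sqzero V)
  sqzero_mulA sqzero_mulC sqzero_mul1 sqzero_mulDl sqzero_one_neq0.

Definition sqz (v : V) : sqzero V := (0, v).

Lemma sqz_inj : injective sqz. Proof. by move=> v w []. Qed.

Fact sqz_is_additive : zmod_morphism sqz.
Proof. by move=> v w; congr pair; rewrite /= subr0. Qed.
HB.instance Definition _ := GRing.isZmodMorphism.Build V (sqzero V) sqz
  sqz_is_additive.

End SquareZeroExtension.

(** Subtracts the equation [l = r] from the goal, or adds it when given through [esym]. Repeated use
    with multiples of hypotheses leaves an identity for [zmod_ring]. *)
Lemma lincomb (V : zmodType) (l r a b : V) : l = r -> a + r = b + l -> a = b.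
Proof. by move=> -> /addIr. Qed.

(* [raddfMn] comes first: [raddfD] would unfold [_ *+ n.+1] into a sum. *)
Ltac zmod_ring :=
  cbv beta; apply: sqz_inj; rewrite ?(raddfMn, raddfN, raddfD, raddf0) /=; ring.


(** * Sums over pairs of indices and over zero-padded tuples *)

Lemma sum_pairs (V : nmodType) n (f : 'I_n -> 'I_n -> V) :
  \sum_i \sum_j f i j =
  \sum_(i < n) \sum_(j < n | (i < j)%N) (f i j + f j i) + \sum_i f i i.
Proof.
have -> : \sum_(i < n) \sum_(j < n | (i < j)%N) (f i j + f j i) =
    \sum_(i < n) \sum_(j < n | (i < j)%N) f i j
    + \sum_(i < n) \sum_(j < n | (j < i)%N) f i j.
  under eq_bigr do rewrite big_split /=.
  rewrite big_split /=; congr (_ + _).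
  exact: (exchange_big_dep xpredT).
rewrite -!big_split /=; apply: eq_bigr => i _.
rewrite (bigID (fun j : 'I_n => (i < j)%N)) /= -addrA; congr (_ + _).
rewrite (bigD1 i) ?ltnn //= addrC; congr (_ + _).
by apply: eq_bigl => j; rewrite -leqNgt ltn_neqAle andbC.
Qed.

(** Indices beyond the size of [s] return the default 0, so a short list stands for the [n]-tuple
    padded with zeros. *)
Lemma sum_nth_padded (U V : zmodType) n (s : seq U) (F : U -> V) :
  (size s <= n)%N ->
  \sum_(i < n) F s`_i = \sum_(z <- s) F z + F 0 *+ (n - size s).
Proof.
move=> les; rewrite -(big_mkord xpredT (fun i => F s`_i)).
rewrite (big_cat_nat (n := size s)) //= -(big_nth 0 xpredT); congr (_ + _).
rewrite (eq_big_nat _ _ (F2 := fun=> F 0)).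
  by rewrite sumr_const_nat.
by move=> i /andP[lesi _]; rewrite nth_default.
Qed.

Lemma lmod_mulIn (R : numFieldType) (V : lmodType R) n (v w : V) :
  (0 < n)%N -> v *+ n = w *+ n -> v = w.
Proof.
move=> n0; rewrite -!scaler_nat; apply: scalerI.
by rewrite pnatr_eq0 -lt0n.
Qed.

Section QuadraticFunctional.
Variables (R : numFieldType) (U : zmodType) (V : lmodType R).
Implicit Types (Q : U -> V) (x y z : U).

(** Natural multiples replace the scalars, so that [U] may be any abelian group. *)
Definition pairs_equation n Q := forall x : 'I_n -> U,
  (\sum_(i < n) \sum_(j < n | (i < j)%N) Q (x i - x j)) *+ n =
  \sum_(i < n) Q (\sum_(j < n) x j - x i *+ n).

Definition parallelogram Q := forall x y,
  Q (x + y) + Q (x - y) = Q x *+ 2 + Q y *+ 2.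

Definition polarization Q x y : V := 2^-1 *: (Q (x + y) - Q x - Q y).

(** * From the pairs equation to the parallelogram law *)

Section Pairs.
Variables (n : nat) (Q : U -> V).
Hypotheses (n_gt2 : (2 < n)%N) (Qpairs : pairs_equation n Q).

Lemma pairs_eq0 : Q 0 = 0.
Proof.
have := @sum_pairs V n (fun _ _ => Q 0).
have := Qpairs (fun=> 0).
have -> : \sum_(j < n) (0 : U) - 0 *+ n = 0.
  by rewrite sumr_const card_ord mul0rn subr0.
under eq_bigr do under eq_bigr do rewrite subr0.
under [in X in _ -> X = _ -> _]eq_bigr do rewrite sumr_const card_ord.
under [in X in _ -> _ = X + _ -> _]eq_bigr do rewrite big_split /=.
rewrite big_split /= !sumr_const card_ord.
set T := \sum_i _ => h1 h2.
case: n n_gt2 h1 h2 => [|[|[|m]]] // _ h1 h2.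
(* With n(n - 1)/2 pairs, the zero tuple gives n(n(n - 1) - 2) Q 0 = 0. The factor is n(n - 2)(n +
   1), nonzero as n > 2. *)
apply: (@lmod_mulIn R V ((m.+1 * m.+3) * m.+4)%N) => //; rewrite mul0rn.
apply: (lincomb (congr1 (fun v => v *+ 2) h1)).
apply: (lincomb (congr1 (fun v => v *+ m.+3) h2)).
zmod_ring.
Qed.

(* Reversing the order of the variables preserves the right-hand side and
   replaces each [Q (x i - x j)] by [Q (x j - x i)]. *)
Lemma pairs_even x : Q (- x) = Q x.
Proof.
have n_gt0 : (0 < n)%N by apply: leq_trans n_gt2.
(* Only the n - 1 pairs containing the index 0 have a nonzero difference, and that difference is
   [x]. *)
pose X (i : 'I_n) : U := if i == 0%N :> nat then x else 0.
have XE (f : U -> V) : f 0 = 0 ->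
    \sum_(i < n) \sum_(j < n | (i < j)%N) f (X i - X j) = f x *+ n.-1.
  move=> f0; rewrite (bigD1 (Ordinal n_gt0)) //= [X in _ + X]big1 ?addr0.
    rewrite (eq_bigr (fun=> f x)) => [|j j0]; last first.
      by rewrite /X /= (gtn_eqF j0) subr0.
    rewrite sumr_const; congr (_ *+ _).
    rewrite (eq_card (B := predC1 (Ordinal n_gt0))) ?cardC1 ?card_ord //.
    by move=> j; rewrite !inE -val_eqE /= -lt0n.
  move=> i i0; rewrite big1 // => j ij; rewrite /X.
  have {}i0 : (0 < i)%N by rewrite lt0n; apply: contra i0.
  by rewrite (gtn_eqF i0) (gtn_eqF (ltn_trans i0 ij)) subr0.
have rev_eq : \sum_(i < n) \sum_(j < n | (i < j)%N) Q (- (X i - X j)) =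
              \sum_(i < n) \sum_(j < n | (i < j)%N) Q (X i - X j).
  apply: (@lmod_mulIn R V n) => //.
  rewrite Qpairs [LHS](_ : _ = (\sum_(i < n) \sum_(j < n | (i < j)%N)
    Q (X (rev_ord i) - X (rev_ord j))) *+ n).
    rewrite (Qpairs (fun i => X (rev_ord i))).
    rewrite [RHS](reindex_inj rev_ord_inj) /=; apply: eq_bigr => i _.
    by rewrite [in RHS](reindex_inj rev_ord_inj).
  congr (_ *+ n); rewrite (exchange_big_dep xpredT) //=.
  rewrite (reindex_inj rev_ord_inj) /=; apply: eq_bigr => i _.
  rewrite (reindex_inj rev_ord_inj) /=; apply: eq_big => j.
    by rewrite ltn_sub2lE ?ltnS // ltn_ord.
  by move=> _; rewrite opprB.
apply: (@lmod_mulIn R V n.-1); first by case: n n_gt2 => [|[]].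
rewrite -(XE Q) ?pairs_eq0 // -rev_eq (XE (fun z => Q (- z))) //.
by rewrite oppr0 pairs_eq0.
Qed.

(** Since [Q] is even and vanishes at 0, the sum over i < j is half of the full double sum; hence
    the doubled right-hand side. In the double sum each entry of [s] meets each padding zero
    twice. *)
Lemma pairs_seq (s : seq U) : (size s <= n)%N ->
  (\sum_(z <- s) \sum_(w <- s) Q (z - w)
     + (\sum_(z <- s) Q z) *+ 2 *+ (n - size s)) *+ n =
  (\sum_(z <- s) Q (\sum_(w <- s) w - z *+ n)
     + Q (\sum_(w <- s) w) *+ (n - size s)) *+ 2.
Proof.
move=> les.
have sumS : \sum_(j < n) s`_j = \sum_(w <- s) w.
  by rewrite (sum_nth_padded id les) mul0rn addr0.
have full : \sum_(i < n) \sum_(j < n) Q (s`_i - s`_j) =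
    (\sum_(i < n) \sum_(j < n | (i < j)%N) Q (s`_i - s`_j)) *+ 2.
  rewrite sum_pairs [X in _ + X]big1 => [|i _]; last by rewrite subrr pairs_eq0.
  rewrite addr0 -sumrMnl; apply: eq_bigr => i _.
  rewrite -sumrMnl; apply: eq_bigr => j _.
  by rewrite -[s`_j - _]opprB pairs_even mulr2n.
have <- : \sum_(i < n) Q (\sum_(j < n) s`_j - s`_i *+ n) =
    \sum_(z <- s) Q (\sum_(w <- s) w - z *+ n)
     + Q (\sum_(w <- s) w) *+ (n - size s).
  rewrite sumS (sum_nth_padded (fun z => Q (_ - z *+ n)) les).
  by rewrite mul0rn subr0.
rewrite -(Qpairs (fun i => s`_i)) [RHS]mulrnAC -full; congr (_ *+ n).
rewrite (sum_nth_padded (fun z => \sum_(j < n) Q (z - s`_j)) les).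
rewrite (sum_nth_padded (fun z => Q (0 - z)) les).
rewrite subr0 pairs_eq0 mul0rn addr0.
under [in RHS]eq_bigr => z _.
  rewrite (sum_nth_padded (fun w => Q (z - w)) les) subr0.
over.
rewrite big_split /= -addrA; congr (_ + _).
under [X in _ = _ + X *+ _]eq_bigr do rewrite sub0r pairs_even.
by rewrite sumrMnl mulr2n mulrnDl.
Qed.

(** Evaluation at (x, 0, ..., 0); for n = 3 it gives Q (2x) = 4 Q x. *)
Lemma pairs_pred x : Q (x *+ n.-1) = Q x *+ (n.-1 ^ 2).
Proof.
have := pairs_seq (s := [:: x]).
rewrite !big_cons !big_nil /= !addr0 subrr pairs_eq0 add0r.
case: n n_gt2 => // m m_gt1 /(_ isT); rewrite subn1 /= => h.
rewrite -pairs_even (_ : - _ = x - x *+ m.+1); last by zmod_ring.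
apply: (@lmod_mulIn R V 2) => //; apply: (lincomb (esym h)); zmod_ring.
Qed.

(** Evaluation at (x, -x, 0, ..., 0). *)
Lemma pairs_double_nat x :
  (Q (x *+ 2) + Q x *+ 2 *+ (n - 2)) *+ n = Q (x *+ n) *+ 2.
Proof.
have := pairs_seq (s := [:: x; - x]).
rewrite !big_cons !big_nil /= !addr0 !subrr pairs_eq0 !add0r mul0rn addr0.
rewrite (ltnW n_gt2) => /(_ isT).
rewrite opprK mulNrn opprK !pairs_even addr0.
rewrite (_ : - x - x = - (x *+ 2)) ?pairs_even -?mulr2n; last by zmod_ring.
move=> h; apply: (@lmod_mulIn R V 2) => //.
apply: (lincomb h); zmod_ring.
Qed.

Lemma pairs_parallelogram_gt3 : (3 < n)%N -> parallelogram Q.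
Proof.
move=> n_gt3 x y.
have := pairs_seq (s := [:: x; - x; y; - y]) n_gt3.
rewrite !big_cons !big_nil /= !addr0.
have -> : x + (- x + (y - y)) = 0 by zmod_ring.
rewrite !sub0r !mulNrn !opprK !subrr pairs_eq0 mul0rn addr0 !pairs_even.
have -> : - x - x = - (x *+ 2) by zmod_ring.
have -> : - y - y = - (y *+ 2) by zmod_ring.
have -> : - x + y = - (x - y) by zmod_ring.
have -> : - x - y = - (x + y) by zmod_ring.
have -> : - y - x = - (x + y) by zmod_ring.
have -> : - y + x = x - y by zmod_ring.
have -> : y - x = - (x - y) by zmod_ring.
rewrite (addrC y x) -!mulr2n !pairs_even ?addNr ?pairs_eq0.
have := pairs_double_nat x; have := pairs_double_nat y.
case: n n_gt3 => [|[|[|[|m]]]] // _; rewrite !subSS !subn0 => hy hx h.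
(* Subtracting twice [hx] and twice [hy] from [h] cancels the values at 2x, 2y, nx and ny, and
   leaves 4n times the parallelogram law. *)
apply: (@lmod_mulIn R V (4 * m.+4)%N) => //.
apply: (lincomb h).
apply: (lincomb (esym (congr1 (fun v => v *+ 2) hx))).
apply: (lincomb (esym (congr1 (fun v => v *+ 2) hy))).
zmod_ring.
Qed.



Lemma pairs_parallelogram_eq3 : n = 3%N -> parallelogram Q.
Proof.
move=> n3.
have Q2 z : Q (z *+ 2) = Q z *+ 4 by have := pairs_pred z; rewrite n3.
have Q3 z : Q (z *+ 3) = Q z *+ 9.
  have := pairs_double_nat z; rewrite n3 Q2 (_ : (3 - 2)%N = 1%N) // => h.
  by apply: (@lmod_mulIn R V 2) => //; apply: (lincomb (esym h)); zmod_ring.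
(* The triple has sum zero, so its right-hand terms are Q (-3z) = 9 Q z; its differences are, up to
   sign, x - 3y, 2x and x + 3y. *)
have step3 x y : Q (x + y *+ 3) + Q (x - y *+ 3) + Q x *+ 4 =
    (Q (x + y) + Q (x - y)) *+ 3 + Q y *+ 12.
  have := pairs_seq (s := [:: x - y; y *+ 2; - (x + y)]).
  rewrite n3 subnn => /(_ isT); rewrite !big_cons !big_nil /= !addr0.
  have -> : x - y + (y *+ 2 - (x + y)) = 0 by zmod_ring.
  rewrite !sub0r ?mulr0n ?addr0 !mulNrn !opprK !subrr pairs_eq0 !pairs_even.
  rewrite !Q3 Q2.
  have -> : x - y - y *+ 2 = x - y *+ 3 by zmod_ring.
  have -> : x - y + (x + y) = x *+ 2 by zmod_ring.
  have -> : y *+ 2 - (x - y) = - (x - y *+ 3) by zmod_ring.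
  have -> : y *+ 2 + (x + y) = x + y *+ 3 by zmod_ring.
  have -> : - (x + y) - (x - y) = - (x *+ 2) by zmod_ring.
  have -> : - (x + y) - y *+ 2 = - (x + y *+ 3) by zmod_ring.
  rewrite addNr pairs_eq0 !pairs_even Q2 => h.
  by apply: (@lmod_mulIn R V 6) => //; apply: (lincomb h); zmod_ring.
pose q x y k := Q (x + y *~ k).
have qstep x y k : q x y (k + 3) + q x y (k - 3) + q x y k *+ 4 =
    (q x y (k + 1) + q x y (k - 1)) *+ 3 + Q y *+ 12.
  rewrite /q !mulrzDr !mulrNz !(addrA x) mulr1z (_ : y *~ 3 = y *+ 3) //.
  exact: step3.
have qdouble x y k : q x (y *+ 2) k = q x y (2 * k).
  by rewrite /q mulrzA.
have qstep1 x y : q x y 4 + q x y (- 2) + q x y 1 *+ 4 =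
    (q x y 2 + q x y 0) *+ 3 + Q y *+ 12 by apply: (qstep x y 1).
have qstepN1 x y : q x y 2 + q x y (- 4) + q x y (- 1) *+ 4 =
    (q x y 0 + q x y (- 2)) *+ 3 + Q y *+ 12 by apply: (qstep x y (- 1)).
(* The centred fourth difference of [q x y] vanishes at 0. The recurrence for 2y ([h6]) and the
   shifts by 3 and -3 eliminate the values at 6 and -6; [h0] then removes those at 3 and -3, and
   [qstep1] and [qstepN1] those at 4 and -4. *)
have step2 x y : q x y 2 + q x y (- 2) + q x y 0 *+ 6 =
    (q x y 1 + q x y (- 1)) *+ 4.
  have h0 : q x y 3 + q x y (- 3) + q x y 0 *+ 4 =
    (q x y 1 + q x y (- 1)) *+ 3 + Q y *+ 12 := qstep x y 0.
  have h3 : q x y 6 + q x y 0 + q x y 3 *+ 4 =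
    (q x y 4 + q x y 2) *+ 3 + Q y *+ 12 := qstep x y 3.
  have hN3 : q x y 0 + q x y (- 6) + q x y (- 3) *+ 4 =
    (q x y (- 2) + q x y (- 4)) *+ 3 + Q y *+ 12 := qstep x y (- 3).
  have h6 : q x y 6 + q x y (- 6) + q x y 0 *+ 4 =
    (q x y 2 + q x y (- 2)) *+ 3 + Q y *+ 4 *+ 12.
    by have := qstep x (y *+ 2) 0; rewrite !qdouble Q2.
  apply: (@lmod_mulIn R V 6) => //.
  apply: (lincomb (esym h3)); apply: (lincomb (esym hN3)); apply: (lincomb h6).
  apply: (lincomb (esym (congr1 (fun v => v *+ 3) (qstep1 x y)))).
  apply: (lincomb (esym (congr1 (fun v => v *+ 3) (qstepN1 x y)))).
  by apply: (lincomb (congr1 (fun v => v *+ 4) h0)); zmod_ring.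
move=> x y.
have h4 : q x y 4 + q x y (- 4) + q x y 0 *+ 6 =
    (q x y 2 + q x y (- 2)) *+ 4.
  by have := step2 x (y *+ 2); rewrite !qdouble.
suff : q x y 1 + q x y (- 1) = q x y 0 *+ 2 + Q y *+ 2.
  by rewrite /q mulr1z mulrNz mulr1z mulr0z addr0.
(* Eliminating the values at 4 and -4 by [h4], and those at 2 and -2 by [step2], leaves 12 times the
   law. *)
apply: (@lmod_mulIn R V 12) => //.
apply: (lincomb (qstep1 x y)); apply: (lincomb (qstepN1 x y)).
apply: (lincomb (esym h4)).
by apply: (lincomb (esym (congr1 (fun v => v *+ 2) (step2 x y)))); zmod_ring.
Qed.

End Pairs.

(** * Polarization, and the converse implication *)

Lemma parallelogram_eq0 Q : parallelogram Q -> Q 0 = 0.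
Proof.
move=> QP; have := QP 0 0; rewrite subr0 addr0 => h.
by apply: (@lmod_mulIn R V 2) => //; apply: (lincomb (esym h)); zmod_ring.
Qed.

Lemma polarizationC Q : symmetric_map (polarization Q).
Proof. by move=> x y; rewrite /polarization (addrC x) addrAC. Qed.

(** The Jordan-von Neumann argument: in [h1] - [h2] + [h3] the values at x - x' + y and x' + y - x
    cancel, and twice [h4] removes the value at x - x'. *)
Lemma polarizationDl Q x x' y : parallelogram Q ->
  polarization Q (x + x') y = polarization Q x y + polarization Q x' y.
Proof.
move=> QP; rewrite /polarization -scalerDr; congr (_ *: _).
have even z : Q (- z) = Q z.
  have := QP 0 z; rewrite add0r sub0r (parallelogram_eq0 QP) => h.
  by apply: (lincomb h); zmod_ring.
have h1 := QP (x + y) x'.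
have h2 := QP (x - x') y.
have h3 := QP (x' + y) x.
have h4 := QP x x'.
have e1 : x + y - x' = x - x' + y by zmod_ring.
have e2 : x - x' - y = - (x' + y - x) by zmod_ring.
have e3 : x + y + x' = x + x' + y by zmod_ring.
have e4 : x' + y + x = x + x' + y by zmod_ring.
rewrite e1 e3 in h1; rewrite e2 even in h2; rewrite e4 in h3.
apply: (@lmod_mulIn R V 2) => //.
apply: (lincomb h1); apply: (lincomb (esym h2)); apply: (lincomb h3).
by apply: (lincomb (esym (congr1 (fun v => v *+ 2) h4))); zmod_ring.
Qed.

Lemma polarization_biadditive Q :
  parallelogram Q -> biadditive (polarization Q).
Proof.
move=> QP; split=> x x' y; first exact: polarizationDl.
by rewrite ![polarization Q x _]polarizationC polarizationDl.
Qed.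

Lemma polarization_diag Q x : parallelogram Q -> polarization Q x x = Q x.
Proof.
move=> QP; have := QP x x; rewrite subrr (parallelogram_eq0 QP) addr0 => h.
rewrite /polarization h (_ : _ - _ - _ = 2%:R *: Q x).
  by rewrite scalerA mulVf ?scale1r // pnatr_eq0.
by rewrite scaler_nat; zmod_ring.
Qed.

Lemma biadditive_pairs n (B : U -> U -> V) : symmetric_map B -> biadditive B ->
  pairs_equation n (fun x => B x x).
Proof.
move=> Bsym [BDl BDr] x.
have B0l y : B 0 y = 0 by apply: (addIr (B 0 y)); rewrite -BDl !add0r.
have B0r y : B y 0 = 0 by rewrite Bsym.
have BNl y z : B (- y) z = - B y z.
  by apply: (addrI (B y z)); rewrite -BDl !subrr.
have BNr y z : B y (- z) = - B y z by rewrite !(Bsym y) BNl.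
have BMr y z m : B y (z *+ m) = B y z *+ m.
  by elim: m => [|m IHm]; rewrite ?mulr0n // !mulrSr BDr IHm.
have BMl y z m : B (y *+ m) z = B y z *+ m by rewrite !(Bsym _ z) BMr.
have Bsuml y : B (\sum_j x j) y = \sum_j B (x j) y.
  exact: (big_morph (B^~ y) (fun a b => BDl a b y)).
have Bsumr y : B y (\sum_j x j) = \sum_j B y (x j).
  exact: (big_morph (B y) (BDr y)).
set S := \sum_j x j; set T := \sum_i B (x i) (x i).
have sq y z : B (y - z) (y - z) = B y y + B z z - B y z *+ 2.
  by rewrite !(BDl, BDr, BNl, BNr) (Bsym z y); zmod_ring.
have swap y z : B (y - z) (y - z) + B (z - y) (z - y) = B (y - z) (y - z) *+ 2.
  by rewrite -(opprB y z) BNl BNr opprK mulr2n.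
(* The full double sum counts each pair twice, so twice the sum over pairs is 2n T - 2 B(S, S). *)
have := sum_pairs (fun i j => B (x i - x j) (x i - x j)).
rewrite [X in _ = _ + X]big1 ?addr0 => [|i _]; last by rewrite subrr.
under eq_bigr do under eq_bigr do rewrite sq.
under eq_bigr do rewrite !big_split /= sumr_const card_ord sumrN sumrMnl -Bsumr.
rewrite !big_split /= sumr_const card_ord sumrN !sumrMnl -Bsuml -/S -/T.
under eq_bigr do under eq_bigr do rewrite swap.
under eq_bigr do rewrite sumrMnl.
rewrite sumrMnl => h.
under [RHS]eq_bigr do rewrite sq BMl !BMr.
rewrite !big_split /= sumr_const card_ord sumrN !sumrMnl -Bsumr -/S -/T.
apply: (@lmod_mulIn R V 2) => //.
apply: (lincomb (congr1 (fun v => v *+ n) (esym h))); zmod_ring.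
Qed.

Lemma pairs_equationP n Q : (2 < n)%N ->
  pairs_equation n Q <-> parallelogram Q.
Proof.
move=> n_gt2; split=> [Qn | QP].
  case: (ltngtP n 3%N) => [|n_gt3|n3].
  - by rewrite ltnS leqNgt n_gt2.
  - exact: pairs_parallelogram_gt3 Qn n_gt3.
  - exact: pairs_parallelogram_eq3 Qn n3.
have QB := biadditive_pairs (n := n) (@polarizationC Q)
  (polarization_biadditive QP).
move=> x; have := QB x.
under eq_bigr do under eq_bigr do rewrite polarization_diag //.
by under [in X in _ = X]eq_bigr do rewrite polarization_diag //.
Qed.

End QuadraticFunctional.

Theorem theorem2p4 (R : realType) (U V : lmodType R) (n : nat) (hn : (2 < n)%N)
    (Q : U -> V) :
  ((forall x : 'I_n -> U,
      n%:R *: (\sum_(i < n) \sum_(j < n | (i < j)%N) Q (x i - x j)) =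
      \sum_(i < n) Q ((\sum_(j < n) x j) - n%:R *: x i))
   <->
   (forall x y : U, Q (x + y) + Q (x - y) = 2%:R *: Q x + 2%:R *: Q y))
  /\
  ((forall x : 'I_n -> U,
      n%:R *: (\sum_(i < n) \sum_(j < n | (i < j)%N) Q (x i - x j)) =
      \sum_(i < n) Q ((\sum_(j < n) x j) - n%:R *: x i)) ->
   exists B : U -> U -> V,
     [/\ symmetric_map B, biadditive B & forall x : U, Q x = B x x]).
Proof.
(* The scalar multiples of the statement are traded for natural multiples. *)
have pairsE : (forall x : 'I_n -> U,
    n%:R *: (\sum_(i < n) \sum_(j < n | (i < j)%N) Q (x i - x j)) =
    \sum_(i < n) Q ((\sum_(j < n) x j) - n%:R *: x i)) <-> pairs_equation n Q.
  split=> h x; [rewrite -scaler_nat | rewrite scaler_nat]; rewrite h;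
    by apply: eq_bigr => i _; rewrite scaler_nat.
have parE : (forall x y : U, Q (x + y) + Q (x - y) = 2%:R *: Q x + 2%:R *: Q y)
    <-> parallelogram Q.
  by split=> h x y; have := h x y; rewrite !scaler_nat.
split; first by rewrite pairsE parE; apply: pairs_equationP.
rewrite pairsE pairs_equationP // => QP; exists (polarization Q); split.
- exact: polarizationC.
- exact: polarization_biadditive.
- by move=> x; rewrite polarization_diag.
Qed.
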